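(* Let $n\ge 1$ be an integer and let $G$ be a balanced $7$-partite graph with parts $V_1,\dots,V_7$, each of size $n$, such that $G$ contains no copy of $K_4$. If \[ \delta(G)>\frac{132}{31}\,n, \] then $\chi(G)\le 3$.
   Context: All graphs are finite and simple. A balanced $7$-partite graph with parts $V_1,\dots,V_7$ of size $n$ is a graph $G$ whose vertex set is partitioned into the sets $V_1,\dots,V_7$, each of size exactly $n$, with no edge of $G$ having both endpoints in the same $V_i$. For a graph $G$, $\delta(G)$ denotes its minimum degree and $\chi(G)$ its chromatic number; $K_4$ is the complete graph on $4$ vertices. *)

(* Defs.v *)
From mathcomp Require Import all_boot all_order all_algebra.

Set Implicit Arguments.
Unset Strict Implicit.
Unset Printing Implicit Defensive.

Record sgraph (T : finType) := SGraph {
  adj : rel T;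
  adj_sym : symmetric adj;
  adj_irrefl : irreflexive adj
}.

Definition degree (T : finType) (G : sgraph T) (x : T) : nat :=
  #|[set y | adj G x y]|.

(* Every degree is smaller than #|T|, so the default value #|T| only matters
   when T is empty. *)
Definition min_degree (T : finType) (G : sgraph T) : nat :=
  \big[minn/#|T|]_(x : T) degree G x.

Definition complete_adj (r : nat) : rel 'I_r := fun i j => i != j.

Lemma complete_adj_sym (r : nat) : symmetric (@complete_adj r).
Proof. by move=> i j; rewrite /complete_adj eq_sym. Qed.

Lemma complete_adj_irrefl (r : nat) : irreflexive (@complete_adj r).
Proof. by move=> i; rewrite /complete_adj eqxx. Qed.

Definition complete_graph (r : nat) : sgraph 'I_r :=
  SGraph (@complete_adj_sym r) (@complete_adj_irrefl r).

(* Copies are not required to be induced. *)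
Definition contains_copy (S T : finType) (H : sgraph S) (G : sgraph T) : Prop :=
  exists f : S -> T,
    injective f /\ forall x y, adj H x y -> adj G (f x) (f y).

Definition balanced_partite (T : finType) (k n : nat) (G : sgraph T)
    (V : 'I_k -> {set T}) : Prop :=
  [/\ \bigcup_(i < k) V i = [set: T],
      forall i j, i != j -> [disjoint V i & V j],
      forall i, #|V i| = n
    & forall i x y, x \in V i -> y \in V i -> ~~ adj G x y].

Definition colorable (T : finType) (G : sgraph T) (k : nat) : bool :=
  [exists f : {ffun T -> 'I_k}, [forall x, forall y, adj G x y ==> (f x != f y)]].

Lemma colorable_ex (T : finType) (G : sgraph T) : exists k, colorable G k.
Proof.
exists #|T|; apply/existsP; exists [ffun x => enum_rank x].
apply/forallP => x; apply/forallP => y; apply/implyP => xy; rewrite !ffunE.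
by apply/negP => /eqP /enum_rank_inj exy; rewrite exy adj_irrefl in xy.
Qed.

Definition chromatic_number (T : finType) (G : sgraph T) : nat :=
  ex_minn (colorable_ex G).

(* Main.v *)
Require Import Defs.
From mathcomp Require Import all_boot all_order all_algebra.
From mathcomp Require Import zify.

Set Implicit Arguments.
Unset Strict Implicit.
Unset Printing Implicit Defensive.

Import GRing.Theory Num.Theory.

(** Write [N = 7 n] and let [D] be the minimum degree.  The hypothesis gives
    [D > 3/5 N] and [9 D > 38 n], and only these two bounds enter the proof.

    Step one uses [D > 3/5 N] alone and is the case of [K4] of a theorem of
    Goddard and Lyle: the vertices split into an independent set [I] and a set
    [W] that spans no triangle ([independent_triangle_free_split]).  Enlarge the
    graph to an edge-maximal [K4]-free one.  All degree information is used
    through fractional counting: for any weighting of finitely many vertices,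
    some vertex sees more than 3/5 of the total weight.  Call a vertex a hub if
    its neighbourhood contains a 5-cycle (its rim).  Counting shows that a
    vertex [x] adjacent to neither end of an edge [yz] lies, with [y] and [z],
    on the rim of a hub ([hub_of_nonadjacent]), and that two hubs are never
    adjacent ([no_adjacent_hubs]).  Suppose that [h] is a hub, [u] is not
    adjacent to [h], and [u] misses a neighbour [t] of [h].  The first fact,
    for [u] and the edge [ht], gives a hub adjacent to [h], against the second.
    So every non-neighbour of [h] is joined to the whole neighbourhood of [h],
    and [W] can be taken to be that neighbourhood.  If every vertex
    is adjacent to an end of every edge that avoids it, there may be no hub,
    but the neighbourhood of any vertex will do.

    Step two returns to the original graph, with [i = |I|], and shows that [W]
    is bipartite.  A vertex of [W] has at least [D - i] neighbours in [W], and
    a triangle-free graph of order [w] and minimum degree [d] in which some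
    degree [s] satisfies [2 w < 4 d + s] is bipartite
    ([bipartite_of_large_nbhd]).  If [3 i + 14 n < 5 D], any vertex of [W] does.
    Otherwise [i > 2 n], so [I] meets at least three parts.  A vertex of
    [I] in the part [V j] misses [I] and [V j], so [V j] and [I] share at least
    [i + D - 6 n] vertices.  Summing over three parts bounds [i] above, below
    [3 n], so one of these parts also has a vertex outside [I].
    That vertex misses the large intersection of its part with [I], hence
    has at least [2 D - 6 n] neighbours in [W], which is enough
    ([bipartite_outside_independent]).  The third colour goes to [I]. *)

(** * Edge-maximal graphs without a 4-clique *)

Definition K4_free (T : finType) (e : rel T) : Prop :=
  forall a b c d, e a b -> e a c -> e a d -> e b c -> e b d -> e c d -> False.

Definition nbhd (T : finType) (e : rel T) (x : T) : {set T} := [set y | e x y].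

Definition K4_saturated (T : finType) (e : rel T) : Prop :=
  forall x y, x != y -> ~~ e x y ->
    exists p q, [/\ e p q, e x p, e x q, e y p & e y q].

Definition independent (T : finType) (e : rel T) (A : {set T}) : Prop :=
  forall x y, x \in A -> y \in A -> ~~ e x y.

Definition triangle_free (T : finType) (e : rel T) (A : {set T}) : Prop :=
  forall x y z, x \in A -> y \in A -> z \in A ->
    e x y -> e x z -> e y z -> False.

Definition add_edge (T : finType) (e : rel T) (x y : T) : rel T :=
  fun u v => [|| e u v, (u == x) && (v == y) | (u == y) && (v == x)].

Lemma add_edge_sym (T : finType) (e : rel T) (x y : T) :
  symmetric e -> symmetric (add_edge e x y).
Proof.
move=> esym u v; rewrite /add_edge esym; congr orb.
by rewrite orbC; congr orb; rewrite andbC.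
Qed.

Lemma add_edge_irrefl (T : finType) (e : rel T) (x y : T) :
  irreflexive e -> x != y -> irreflexive (add_edge e x y).
Proof.
move=> eirr xy u; rewrite /add_edge eirr /=.
by case: (eqVneq u x) => [->|_] /=; rewrite ?(negbTE xy) ?andbF.
Qed.

(** A clique on four vertices that uses the new edge [xy] consists of [x], [y]
    and an old edge in their common neighbourhood. *)
Lemma add_edge_K4_free (T : finType) (e : rel T) (x y : T) :
  symmetric e -> irreflexive e -> K4_free e -> x != y ->
  (forall p q, e p q -> e x p -> e x q -> e y p -> e y q -> False) ->
  K4_free (add_edge e x y).
Proof.
move=> esym eirr K4 xy noedge.
set e2 := add_edge e x y.
have e2sym : symmetric e2 by apply: add_edge_sym.
have e2irr : irreflexive e2 by apply: add_edge_irrefl.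
have e2ne u v : e2 u v -> u != v.
  by move=> uv; apply/eqP => E; move: uv; rewrite E e2irr.
have old u v : e2 u v -> v != x -> v != y -> e u v.
  by move=> + vx vy; rewrite /e2 /add_edge (negbTE vx) (negbTE vy) !andbF !orbF.
have new a b c d : (a == x) && (b == y) || (a == y) && (b == x) ->
    e2 a c -> e2 a d -> e2 b c -> e2 b d -> e2 c d -> False.
  move=> Hab ac ad bc bd cd.
  have [cx cy dx dy] : [/\ c != x, c != y, d != x & d != y].
    move: (e2ne _ _ ac) (e2ne _ _ ad) (e2ne _ _ bc) (e2ne _ _ bd).
    by case/orP: Hab => /andP [/eqP -> /eqP ->];
      rewrite ![x == _]eq_sym ![y == _]eq_sym => -> -> -> ->.
  have {}ac := old _ _ ac cx cy; have {}ad := old _ _ ad dx dy.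
  have {}bc := old _ _ bc cx cy; have {}bd := old _ _ bd dx dy.
  have {}cd := old _ _ cd dx dy.
  case/orP: Hab => /andP [/eqP Ea /eqP Eb]; subst a b.
    exact: (noedge c d).
  exact: (noedge c d).
have split u v : e2 u v ->
    e u v \/ ((u == x) && (v == y) || (u == y) && (v == x)).
  by rewrite /e2 /add_edge => /orP [|]; [left|right].
move=> a b c d ab ac ad bc bd cd.
have S u v : e2 u v -> e2 v u by rewrite e2sym.
case: (split _ _ ab) => [ab'|N]; last exact: (new a b c d).
case: (split _ _ ac) => [ac'|N]; last by apply: (new a c b d) => //; apply: S.
case: (split _ _ ad) => [ad'|N]; last by apply: (new a d b c) => //; apply: S.
case: (split _ _ bc) => [bc'|N]; last by apply: (new b c a d) => //; apply: S.
case: (split _ _ bd) => [bd'|N]; last by apply: (new b d a c) => //; apply: S.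
case: (split _ _ cd) => [cd'|N]; last by apply: (new c d a b) => //; apply: S.
exact: (K4 a b c d).
Qed.

Lemma K4_saturated_extension (T : finType) (e : rel T) :
  symmetric e -> irreflexive e -> K4_free e ->
  exists e' : rel T, [/\ subrel e e', symmetric e', irreflexive e',
    K4_free e' & K4_saturated e'].
Proof.
have [k] := ubnP #|[set p : T * T | ~~ e p.1 p.2]|.
elim: k e => // k IH e lek esym eirr K4.
pose bad (p : T * T) := [&& p.1 != p.2, ~~ e p.1 p.2 &
  ~~ [exists q : T * T, [&& e q.1 q.2, e p.1 q.1, e p.1 q.2, e p.2 q.1 & e p.2 q.2]]].
case: (pickP bad) => [[x y] /and3P [/= xy nexy noq] | sat].
  have [||||e' [sub e's e'i e'K e'S]] := IH (add_edge e x y).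
  - rewrite -ltnS; apply: leq_ltn_trans lek; apply: proper_card.
    rewrite properE; apply/andP; split; apply/subsetP.
      by move=> p; rewrite !inE negb_or => /andP [].
    by move/(_ (x, y)); rewrite !inE /= nexy /add_edge !eqxx orbT => /(_ isT).
  - exact: add_edge_sym.
  - exact: add_edge_irrefl.
  - apply: add_edge_K4_free => // p q pq xp xq yp yq.
    by case/negP: noq; apply/existsP; exists (p, q); apply/and5P.
  by exists e'; split=> // u v uv; apply: sub; rewrite /add_edge uv.
exists e; split=> // x y xy nexy.
have := sat (x, y); rewrite /bad /= xy nexy /= => /negbFE /existsP [[p q]].
by case/and5P => /= *; exists p, q.
Qed.

(** * Fractional counting *)

(** A list stands for a weighting of vertices by multiplicities; the condition
    says that some vertex sees more than 3/5 of the weight. *)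
Definition dense (T : finType) (e : rel T) : Prop :=
  forall s : seq T, s != [::] -> exists v, 3 * size s < 5 * count (e v) s.

(** The weight seen by a vertex, averaged over all vertices, is the sum of the
    degrees of the listed vertices divided by the order. *)
Lemma dense_of_degrees (T : finType) (e : rel T) : symmetric e ->
  (forall x, 3 * #|T| < 5 * #|nbhd e x|) -> dense e.
Proof.
move=> esym deg s s0.
case: (pickP (fun v => 3 * size s < 5 * count (e v) s)) => [v Hv|none].
  by exists v.
have double : \sum_(v : T) count (e v) s = \sum_(x <- s) #|nbhd e x|.
  under eq_bigr => v _ do rewrite -sum1_count big_mkcond /=.
  rewrite exchange_big /=; apply: eq_bigr => x _.
  rewrite -sum1_card [RHS]big_mkcond /=; apply: eq_bigr => v _.
  by rewrite inE esym.
have up : 5 * \sum_(v : T) count (e v) s <= #|T| * (3 * size s).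
  rewrite big_distrr /= -sum_nat_const; apply: leq_sum => v _.
  by have := none v; lia.
have low : size s * (3 * #|T|).+1 <= 5 * \sum_(x <- s) #|nbhd e x|.
  rewrite big_distrr /= mulnC -[size s]count_predT.
  rewrite -sum1_count big_distrr /=; apply: leq_sum => x _.
  by rewrite muln1 deg.
have : 0 < size s by case: (s) s0.
by move: up low; rewrite double; nia.
Qed.

(** * Hubs of wheels over 5-cycles *)

Section Wheels.

Variables (T : finType) (e : rel T).
Hypothesis esym : symmetric e.
Hypothesis K4 : K4_free e.
Hypothesis dens : dense e.

Definition wheel (h a b c d f : T) : Prop :=
  [/\ e h a, e h b, e h c, e h d & e h f] /\
  [/\ e a b, e b c, e c d, e d f & e f a].

Definition hub (h : T) : Prop := exists a b c d f, wheel h a b c d f.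

Lemma no_K4 v a b c : e a b -> e a c -> e b c ->
  [&& e v a, e v b & e v c] = false.
Proof.
move=> ab ac bc; apply/negP => /and3P [va vb vc].
exact: (K4 va vb vc ab ac bc).
Qed.

(** Saturation gives edges [pq] and [rs] in the common neighbourhoods of [x]
    with [y] and with [z].  Some vertex sees at least five of these seven
    vertices; avoiding 4-cliques it sees [x], [y], [z] and one end of each of
    the two edges, which makes it a hub. *)
Lemma hub_of_nonadjacent x y z : K4_saturated e ->
  x != y -> x != z -> ~~ e x y -> ~~ e x z -> e y z ->
  exists q p r, wheel q x p y z r.
Proof.
move=> sat xy xz nxy nxz yz.
have [p [q [pq xp xq yp yq]]] := sat x y xy nxy.
have [r [s [rs xr xs zr zs]]] := sat x z xz nxz.
have [v] := dens (s := [:: x; y; z; p; q; r; s]) isT.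
have := no_K4 v xp xq pq; have := no_K4 v yp yq pq.
have := no_K4 v xr xs rs; have := no_K4 v zr zs rs.
rewrite /= !addnA addn0 => F1 F2 F3 F4 cnt.
have [vx vy vz vpq vrs] :
    [/\ e v x, e v y, e v z, e v p || e v q & e v r || e v s].
  by move: F1 F2 F3 F4 cnt; do 7 case: (e v _).
have [p' [vp' xp' yp']] : exists p', [/\ e v p', e x p' & e y p'].
  by case/orP: vpq => H; [exists p | exists q].
have [r' [vr' xr' zr']] : exists r', [/\ e v r', e x r' & e z r'].
  by case/orP: vrs => H; [exists r | exists s].
by exists v, p', r'; split; split=> //; rewrite esym.
Qed.

(** In the triangle-free neighbourhood of [h] all degrees exceed one third of
    the order, so the neighbourhoods of [a] and of the ends of an edge cannot be
    pairwise disjoint. *)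
Lemma common_nbr_edge h a c d : e h a -> e h c -> e h d -> e c d ->
  exists u, [/\ e h u, e a u & e u c || e u d].
Proof.
move=> ha hc hd cd.
(* The weight 2 on [h] forces [v] into the neighbourhood of [h]. *)
have [v] := dens (s := [:: h; h; a; c; d]) isT.
have := no_K4 v hc hd cd.
rewrite /= !addnA addn0 => F cnt.
exists v; rewrite esym [e a v]esym.
by move: F cnt; do 4 case: (e v _).
Qed.

(** The rim vertices of [h] that share with [g] a neighbour in the
    neighbourhood of [h] form a vertex cover of the rim, by [common_nbr_edge].
    A vertex cover of a 5-cycle contains two consecutive vertices, and these
    close a 5-cycle through [g]. *)
Lemma wheel_through h g : hub h -> e h g ->
  exists b c d f, wheel h g b c d f.
Proof.
move=> [c1 [c2 [c3 [c4 [c5 [[h1 h2 h3 h4 h5] [e12 e23 e34 e45 e51]]]]]]] hg.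
pose P c := exists u, [/\ e h u, e g u & e u c].
have cover c d : e h c -> e h d -> e c d -> P c \/ P d.
  move=> hc hd cd; have [u [hu gu /orP [uc|ud]]] := common_nbr_edge hg hc hd cd.
    by left; exists u.
  by right; exists u.
have close c d : e h c -> e h d -> e c d -> P c -> P d ->
    exists b c d f, wheel h g b c d f.
  move=> hc hd cd [u [hu gu uc]] [w [hw gw wd]].
  by exists u, c, d, w; split; split=> //; rewrite esym.
have C12 := cover _ _ h1 h2 e12; have C23 := cover _ _ h2 h3 e23.
have C34 := cover _ _ h3 h4 e34; have C45 := cover _ _ h4 h5 e45.
have C51 := cover _ _ h5 h1 e51.
have K12 := close _ _ h1 h2 e12; have K23 := close _ _ h2 h3 e23.
have K34 := close _ _ h3 h4 e34; have K45 := close _ _ h4 h5 e45.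
have K51 := close _ _ h5 h1 e51.
tauto.
Qed.

(** Once the rim passes through [g], it can be rerouted through any edge at [g]
    by joining [a] to an end of the opposite edge of the rim. *)
Lemma wheel_through_edge h g a : hub h -> e h g -> e h a -> e g a ->
  exists c d f, wheel h g a c d f.
Proof.
move=> hubh hg ha ga.
have [b [c [d [f [[_ hb hc hd hf] [gb bc cd df fg]]]]]] := wheel_through hubh hg.
have [u [hu au /orP [uc|ud]]] := common_nbr_edge ha hc hd cd.
  exists u, c, b; split; split=> //; first by rewrite esym.
  by rewrite esym.
by exists u, d, f.
Qed.

(** Excludes the one adjacency pattern that would break the weighting in
    [no_adjacent_hubs]: [w1 w3 w4 w5] is the path that a rim through [x] leaves
    in the neighbourhood of [y], and [w2] follows [w1] on a rim through [y] in
    the neighbourhood of [x].  Adding [v] to these vertices, with weight 2 on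
    [x] and [y] and weight 1 elsewhere, gives total weight 10, of which a
    vertex can see at most 6. *)
Lemma no_apex_on_opposite_path x y w1 w2 w3 w4 w5 v :
  e x y -> e x w1 -> e y w1 -> e x w5 -> e y w5 -> e x w2 -> e w1 w2 ->
  e y w3 -> e y w4 -> e w1 w3 -> e w3 w4 -> e w4 w5 ->
  [&& e v x, e v w2, e v w3 & e v w4] = false.
Proof.
move=> xy xw1 yw1 xw5 yw5 xw2 w12 yw3 yw4 w13 w34 w45.
apply/negP => /and4P [vx vw2 vw3 vw4].
have [u] := dens (s := [:: x; x; y; y; w1; w5; w2; w3; w4; v]) isT.
have xv : e x v by rewrite esym.
have w2v : e w2 v by rewrite esym.
have w3v : e w3 v by rewrite esym.
have w4v : e w4 v by rewrite esym.
have := no_K4 u xy xw1 yw1; have := no_K4 u xy xw5 yw5.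
have := no_K4 u xw1 xw2 w12; have := no_K4 u xw2 xv w2v.
have := no_K4 u yw3 yw4 w34; have := no_K4 u yw1 yw3 w13.
have := no_K4 u yw4 yw5 w45; have := no_K4 u w34 w3v w4v.
move=> /=.
by do 8 case: (e u _).
Qed.

(** Both rims can be routed through a common neighbour [a] of the two hubs.
    Weight 2 on each hub and weight 1 on the six remaining rim vertices gives
    total weight 10; a vertex sees at most 6 of it, unless it is joined to one
    hub, to the next rim vertex [c3] or [d3] there and to the edge of the other
    rim opposite to that hub, which [no_apex_on_opposite_path] forbids. *)
Lemma no_adjacent_hubs h g : hub h -> hub g -> e h g -> False.
Proof.
move=> hubh hubg hg; have gh : e g h by rewrite esym.
have [a [c3 [c4 [c5 [[_ ha hc3 hc4 hc5] [ga ac3 c34 c45 c5g]]]]]] :=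
  wheel_through hubh hg.
have [d3 [d4 [d5 [[_ _ gd3 gd4 gd5] [_ ad3 d34 d45 d5h]]]]] :=
  wheel_through_edge hubg gh ga ha.
have gc5 : e g c5 by rewrite esym.
have hd5 : e h d5 by rewrite esym.
have nod v : [&& e v h, e v c3, e v d3 & e v d4] = false.
  exact: (no_apex_on_opposite_path v hg ha ga hd5 gd5 hc3 ac3 gd3 gd4
    ad3 d34 d45).
have noc v : [&& e v g, e v d3, e v c3 & e v c4] = false.
  exact: (no_apex_on_opposite_path v gh ga ha gc5 hc5 gd3 ad3 hc3 hc4
    ac3 c34 c45).
have [u] := dens (s := [:: h; h; g; g; c5; d5; c3; c4; d3; d4]) isT.
have := nod u; have := noc u.
have := no_K4 u hg hc5 gc5; have := no_K4 u hg hd5 gd5.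
have := no_K4 u hc3 hc4 c34; have := no_K4 u hc4 hc5 c45.
have := no_K4 u gd3 gd4 d34; have := no_K4 u gd4 gd5 d45.
move=> /=.
by do 8 case: (e u _).
Qed.

End Wheels.

(** The set [I] consists of the non-neighbours of a hub, or of any vertex when
    no vertex is adjacent to neither end of an edge that avoids it. *)
Lemma independent_triangle_free_split (T : finType) (e : rel T) :
  symmetric e -> K4_free e -> dense e -> K4_saturated e ->
  exists I : {set T}, independent e I /\ triangle_free e (~: I).
Proof.
move=> esym K4 dens sat.
have tf h : triangle_free e (~: [set u | ~~ e h u]).
  move=> x y z; rewrite !inE !negbK => hx hy hz xy xz yz.
  exact: (K4 h x y z).
pose apart (t : T * T * T) := let: (x, y, z) := t in
  [&& x != y, x != z, ~~ e x y, ~~ e x z & e y z].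
case: (pickP apart) => [[[x y] z] /and5P [xy xz nxy nxz yz] | none]; last first.
  case: (pickP (@predT T)) => [h _|empty]; last first.
    by exists set0; split=> x; have := empty x.
  exists [set u | ~~ e h u]; split; last exact: tf.
  move=> x y; rewrite !inE => hx hy; apply/negP => xy.
  have nex : h != x by apply: contraNneq hy => ->.
  have ney : h != y by apply: contraNneq hx => ->; rewrite esym.
  by have := none (h, x, y); rewrite /apart nex ney hx hy xy.
have [h [p [r W]]] := hub_of_nonadjacent esym K4 dens sat xy xz nxy nxz yz.
have hubh : hub e h by exists x, p, y, z, r.
clear x y z p r xy xz nxy nxz yz W.
have full u t : ~~ e h u -> e h t -> e u t.
  move=> hu ht; apply/negPn/negP => ut.
  have neu : u != h by apply: contraNneq ut => ->.
  have net : u != t by apply: contraNneq hu => ->.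
  have uh : ~~ e u h by rewrite esym.
  have [q [p [r W]]] := hub_of_nonadjacent esym K4 dens sat neu net uh ut ht.
  have qh : e q h by case: W => [[]].
  apply: (no_adjacent_hubs esym K4 dens _ hubh qh).
  by exists u, p, h, t, r.
exists [set u | ~~ e h u]; split; last exact: tf.
move=> x y; rewrite !inE => hx hy; apply/negP => xy.
have [a [b [c [d [f [[ha hb _ _ _] [ab _ _ _ _]]]]]]] := hubh.
exact: (K4 x y a b xy (full _ _ hx ha) (full _ _ hx hb)
  (full _ _ hy ha) (full _ _ hy hb) ab).
Qed.

(** * Bipartiteness of the triangle-free side *)

(** One colour class consists of the vertices with a neighbour in
    [X], the neighbourhood of [x] in [W].  If [z] is in that class, through an
    edge [zy] with [y] in [X], then [y] has its neighbours outside [X] and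
    shares none with [z]; this leaves [z] more than half of [X], so two such
    vertices have a common neighbour and are not adjacent.  Two adjacent
    vertices of the other class would have disjoint neighbourhoods
    outside [X], which is too small. *)
Lemma bipartite_of_large_nbhd (T : finType) (e : rel T) (W : {set T}) (d : nat)
    (x : T) :
  triangle_free e W ->
  (forall z, z \in W -> d <= #|nbhd e z :&: W|) ->
  x \in W -> 2 * #|W| < 4 * d + #|nbhd e x :&: W| ->
  exists B : {set T}, forall u v, u \in W -> v \in W -> e u v ->
    (u \in B) != (v \in B).
Proof.
move=> tf deg xW big.
pose N z := nbhd e z :&: W; pose X := N x.
have NP z y : (y \in N z) = e z y && (y \in W) by rewrite !inE.
have disj u v : u \in W -> v \in W -> e u v -> [disjoint N u & N v].
  move=> uW vW uv; rewrite disjoints_subset; apply/subsetP => y.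
  rewrite !inE => /andP [uy yW]; apply/negP => /andP [vy _].
  exact: (tf u v y).
have XW : #|W :\: X| = #|W| - #|X|.
  by rewrite cardsD (setIidPr _) //; apply: subsetIr.
have XleW : #|X| <= #|W| by apply/subset_leq_card/subsetIr.
exists [set z | [exists v in X, e z v]] => u v uW vW uv; rewrite !inE.
have hit z : z \in W -> [exists v in X, e z v] -> 2 * d + #|X| <= #|W| + #|N z :&: X|.
  move=> zW /existsP [y /andP [yX zy]].
  have yW : y \in W by move: yX; rewrite NP => /andP [].
  have xy : e x y by move: yX; rewrite NP => /andP [].
  have sub : (N z :\: X) :|: N y \subset W :\: X.
    apply/subsetP => w; rewrite in_setU in_setD => /orP [/andP [wX wN]|wN].
      by rewrite in_setD wX; move: wN; rewrite NP => /andP [].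
    move: wN; rewrite in_setD NP => /andP [yw wW]; rewrite wW andbT.
    apply/negP; rewrite NP => /andP [xw _].
    exact: (tf x y w).
  have dz : [disjoint N z :\: X & N y].
    exact: disjointWl (subsetDl _ _) (disj _ _ zW yW zy).
  have := subset_leq_card sub; rewrite cardsU.
  move: dz; rewrite -setI_eq0 => /eqP ->; rewrite cards0 XW subn0.
  have := deg z zW; have := deg y yW; rewrite -/(N z) -/(N y).
  by move: XleW (cardsID X (N z)); clear; lia.
case: (boolP [exists w in X, e u w]) => Hu;
  case: (boolP [exists w in X, e v w]) => Hv //; exfalso.
  have sub : (N u :&: X) :|: (N v :&: X) \subset X.
    by rewrite subUset !subsetIr.
  have dd : [disjoint N u :&: X & N v :&: X].
    apply: disjointWl (subsetIl _ _) _; apply: disjointWr (subsetIl _ _) _.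
    exact: disj.
  have := subset_leq_card sub; rewrite cardsU.
  move: dd; rewrite -setI_eq0 => /eqP ->; rewrite cards0 subn0.
  have := hit _ uW Hu; have := hit _ vW Hv; move: big.
  by rewrite -/(N x) -/X; clear; lia.
have miss z : ~~ [exists w in X, e z w] -> N z \subset W :\: X.
  move=> H; apply/subsetP => w; rewrite NP in_setD => /andP [zw ->]; rewrite andbT.
  by apply: contra H => wX; apply/existsP; exists w; rewrite wX.
have sub : N u :|: N v \subset W :\: X by rewrite subUset !miss.
have := subset_leq_card sub; rewrite cardsU.
move: (disj _ _ uW vW uv); rewrite -setI_eq0 => /eqP ->.
rewrite cards0 subn0 XW.
have := deg u uW; have := deg v vW; rewrite -/(N u) -/(N v).
by move: big XleW; rewrite -/(N x) -/X; clear; lia.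
Qed.

(** * The partition into parts of equal size *)

Lemma sum_card_parts (T : finType) (k : nat) (V : 'I_k -> {set T})
    (A : {set T}) :
  \bigcup_(i < k) V i = [set: T] ->
  (forall i j, i != j -> [disjoint V i & V j]) ->
  \sum_(i < k) #|V i :&: A| = #|A|.
Proof.
move=> cov dis; under eq_bigr => i _ do rewrite -sum1_card.
rewrite -partition_disjoint_bigcup -?sum1_card.
  by rewrite -big_distrl /= cov setTI.
move=> i j ij; apply: disjointWl (subsetIl _ _) _.
by apply: disjointWr (subsetIl _ _) _; apply: dis.
Qed.

Lemma card_balanced (T : finType) (k n : nat) (G : sgraph T)
    (V : 'I_k -> {set T}) : balanced_partite n G V -> #|T| = k * n.
Proof.
move=> [cov dis card _]; rewrite -cardsT -(sum_card_parts [set: T] cov dis).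
under eq_bigr => i _ do rewrite setIT card.
by rewrite sum_nat_const card_ord.
Qed.

(** Large neighbourhoods in [~: I] come from a part that meets both [I] and its
    complement: a vertex of [~: I] in such a part loses no degree to the many
    vertices of [I] in its own part. *)
Lemma bipartite_outside_independent (T : finType) (G : sgraph T) (n D : nat)
    (V : 'I_7 -> {set T}) (I : {set T}) :
  0 < n -> balanced_partite n G V ->
  (forall x, D <= degree G x) -> 38 * n < 9 * D ->
  independent (adj G) I -> triangle_free (adj G) (~: I) ->
  exists B : {set T}, forall u v, u \in ~: I -> v \in ~: I -> adj G u v ->
    (u \in B) != (v \in B).
Proof.
move=> n0 hV deg large Iind Wtf.
have cT := card_balanced hV; have [cov dis card indep] := hV.
have parts A := sum_card_parts A cov dis.
have cW : #|I| + #|~: I| = 7 * n by rewrite cardsC cT.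
have degW z : D - #|I| <= #|nbhd (adj G) z :&: ~: I|.
  have := cardsID I (nbhd (adj G) z); have := deg z.
  rewrite /degree -/(nbhd _ _) setDE.
  have : #|nbhd (adj G) z :&: I| <= #|I| by apply/subset_leq_card/subsetIr.
  lia.
have bip := @bipartite_of_large_nbhd T (adj G) (~: I) (D - #|I|).
case: (ltnP (3 * #|I| + 14 * n) (5 * D)) => [small | Ibig].
  have [x xW] : exists x, x \in ~: I.
    apply/set0Pn; rewrite -card_gt0.
    case: (posnP #|~: I|) => // W0.
    have [x _] : exists x, x \in I.
      apply/set0Pn; rewrite -card_gt0; lia.
    have := deg x; have : degree G x <= #|T| by apply: max_card.
    lia.
  apply: (bip x) => //.
  have := degW x; lia.
pose a j := #|V j :&: I|.
have a_le j : a j <= n by rewrite -(card j); apply/subset_leq_card/subsetIl.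
(* A vertex of [I] in the part [V j] is adjacent to nothing in [I] or [V j]. *)
have a_low j : 0 < a j -> #|I| + D <= 6 * n + a j.
  rewrite card_gt0 => /set0Pn [x]; rewrite inE => /andP [xV xI].
  have sub : nbhd (adj G) x \subset ~: (I :|: V j).
    apply/subsetP => y; rewrite !inE => xy; rewrite negb_or; apply/andP; split.
      by apply/negP => yI; have := Iind x y xI yI; rewrite xy.
    by apply/negP => yV; have := indep j x y xV yV; rewrite xy.
  have := subset_leq_card sub; have := deg x.
  have := cardsC (I :|: V j); have := cardsUI I (V j).
  rewrite /degree -/(nbhd _ _) cT (card j) [I :&: V j]setIC -/(a j).
  lia.
pose J := [pred j | 0 < a j].
have sumJ : \sum_(j | J j) a j = #|I|.
  rewrite -(parts I) [RHS](bigID J) /=.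
  rewrite [X in _ + X]big1 ?addn0 // => j; rewrite lt0n negbK => /eqP.
  exact.
have upper : #|I| <= #|J| * n.
  rewrite -sumJ -sum_nat_const; exact: leq_sum.
have J3 : 3 <= #|J|.
  rewrite leqNgt; apply/negP => J2.
  have : #|J| * n <= 2 * n by rewrite leq_mul2r -ltnS J2 orbT.
  lia.
have lower : #|J| * (#|I| + D - 6 * n) <= #|I|.
  rewrite -{2}sumJ -sum_nat_const; apply: leq_sum => j Jj.
  by have := a_low j Jj; lia.
have Ile : 2 * #|I| + 3 * D <= 18 * n.
  have : 3 * (#|I| + D - 6 * n) <= #|I|.
    by apply: leq_trans lower; rewrite leq_mul2r J3 orbT.
  lia.
have [j /andP [Jj jn]] : exists j, J j && (a j < n).
  case: (pickP (fun j => J j && (a j < n))) => [j Hj|none]; first by exists j.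
  have : #|J| * n <= #|I|.
    rewrite -sumJ -sum_nat_const; apply: leq_sum => j Jj.
    by have := none j; rewrite -[J j]/(j \in J) Jj /= ltnNge => /negbFE.
  have : 3 * n <= #|J| * n by rewrite leq_mul2r J3 orbT.
  lia.
have [x] : exists x, x \in V j :\: I.
  apply/set0Pn; rewrite -card_gt0; have := cardsID I (V j).
  by rewrite card -/(a j); lia.
rewrite inE => /andP [xI xV].
have xW : x \in ~: I by rewrite inE.
apply: (bip x) => //.
have sub : nbhd (adj G) x :&: I \subset I :\: V j.
  apply/subsetP => y; rewrite !inE => /andP [xy yI]; rewrite yI andbT.
  by apply/negP => yV; have := indep j x y xV yV; rewrite xy.
have := subset_leq_card sub; have := cardsID (V j) I.
have := cardsID I (nbhd (adj G) x); have := deg x; have := a_low j Jj.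
rewrite /degree -/(nbhd _ _) [I :&: V j]setIC -/(a j) setDE.
lia.
Qed.

(** * Three colours *)

Lemma three_colorable (T : finType) (G : sgraph T) (I B : {set T}) :
  independent (adj G) I ->
  (forall u v, u \in ~: I -> v \in ~: I -> adj G u v ->
    (u \in B) != (v \in B)) ->
  colorable G 3.
Proof.
move=> Iind HB; apply/existsP.
exists [ffun x => if x \in I then inord 0 else if x \in B then inord 1
  else inord 2].
apply/forallP => u; apply/forallP => v; apply/implyP => uv; rewrite !ffunE.
have HI := Iind u v; have := HB u v; rewrite !inE uv.
rewrite -val_eqE /=.
case: (boolP (u \in I)) HI => uI; case: (boolP (v \in I)) => vI HI.
- by have := HI isT isT; rewrite uv.
- by case: (v \in B); rewrite /= !inordK.
- by case: (u \in B); rewrite /= !inordK.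
- move=> /(_ isT isT isT).
  by case: (u \in B); case: (v \in B); rewrite //= !inordK.
Qed.

Lemma K4_free_of_no_copy (T : finType) (G : sgraph T) :
  ~ contains_copy (complete_graph 4) G -> K4_free (adj G).
Proof.
move=> noK a b c d ab ac ad bc bd cd; apply: noK.
pose f (i : 'I_4) := nth a [:: a; b; c; d] i.
have hom i j : i != j -> adj G (f i) (f j).
  case: i => [[|[|[|[|//]]]] i]; case: j => [[|[|[|[|//]]]] j] //= _;
    by rewrite // adj_sym.
exists f; split; last exact: hom.
by move=> i j fij; apply/eqP/negPn/negP => /hom; rewrite fij adj_irrefl.
Qed.

Lemma min_degree_le (T : finType) (G : sgraph T) (x : T) :
  min_degree G <= degree G x.
Proof.
rewrite /min_degree; have := mem_index_enum x.
elim: (index_enum T) => // y s IH; rewrite inE big_cons.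
by case/predU1P => [->|/IH]; rewrite geq_min ?leqnn // => ->; rewrite orbT.
Qed.

Lemma ltn_of_ltr_ratio (a b m n : nat) : 0 < b ->
  (a%:R / b%:R * n%:R < m%:R :> rat)%R -> a * n < b * m.
Proof.
move=> b0; rewrite mulrAC ltr_pdivrMr ?ltr0n //.
by rewrite -!natrM ltr_nat [m * b]mulnC.
Qed.

Theorem lemma3p4 (n : nat) (hn : (1 <= n)%N) (T : finType) (G : sgraph T)
    (V : 'I_7 -> {set T}) (hV : balanced_partite n G V)
    (hK4 : ~ contains_copy (complete_graph 4) G)
    (hdeg : (132%:R / 31%:R * n%:R < (min_degree G)%:R :> rat)%R) :
  (chromatic_number G <= 3)%N.
Proof.
suff col : colorable G 3.
  by rewrite /chromatic_number; case: ex_minnP => m _; apply.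
have {hdeg} large : 132 * n < 31 * min_degree G.
  exact: (ltn_of_ltr_ratio (ltn0Sn 30) hdeg).
have deg := @min_degree_le T G.
have K4 := K4_free_of_no_copy hK4.
have [e [sub esym _ eK4 sat]] :=
  K4_saturated_extension (@adj_sym _ G) (@adj_irrefl _ G) K4.
have cT := card_balanced hV.
have dens : dense e.
  apply: dense_of_degrees => // x.
  have : degree G x <= #|nbhd e x|.
    by apply/subset_leq_card/subsetP => y; rewrite !inE; apply: sub.
  by have := deg x; rewrite cT; lia.
have [I [Iind Wtf]] := independent_triangle_free_split esym eK4 dens sat.
have GI : independent (adj G) I.
  by move=> x y xI yI; apply: contra (Iind x y xI yI); apply: sub.
have GW : triangle_free (adj G) (~: I).
  by move=> x y z xW yW zW xy xz yz; apply: (Wtf x y z) => //; apply: sub.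
have [|B HB] := bipartite_outside_independent hn hV deg _ GI GW; first by lia.
exact: three_colorable GI HB.
Qed.
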